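(* Let $A$ be a set and $f:2^A\to 2^A$ a pseudo-closure. Algorithm $MinGen(A,f)$ (described in the context) computes a minimum generator of any $H\in \mathrm{Im}(f)$ in time $O(c_f(|A|\,|\mathrm{Im}(f)|)^2)$. Moreover, if $f$ is size-increasing, its time-complexity is $O(c_f|A|\,|\mathrm{Im}(f)|)$.
   Context: A function $f: 2^A\to 2^A$ is a pseudo-closure if $f(X\cup Y)=f(f(X)\cup f(Y))$ for all $X,Y\subseteq A$. It is size-increasing if for all $X,Y\subseteq A$ with $X\subseteq Y$ one has $|f(X)|<|f(Y)|$ or $f(X)=f(Y)$. $\mathrm{Im}(f)=\{Y\subseteq A \mid \exists X\subseteq A,\ Y=f(X)\}$. A set $X\subseteq A$ generates $f(X)$ (is a generator of $f(X)$), and $X$ is minimum if there is no $Y\subseteq A$ with $|Y|<|X|$ and $f(X)=f(Y)$. It is assumed that, for any $X'=X\cup\{w\}\subseteq A$ and given $f(X)$, determining $f(X')$ can be done in time $c_f$. Algorithm $MinGen(A,f)$. Input: a set $A$, a pseudo-closure $f:2^A\to 2^A$, and the set $\mathrm{Im}(f)$. (1) For every $H\in \mathrm{Im}(f)\setminus\{f(\emptyset)\}$ set $label(H)\leftarrow H$, and set $label(f(\emptyset))\leftarrow\emptyset$. (2) Set $Continue\leftarrow True$. (3) While $Continue$ is $True$: set $Continue\leftarrow False$; then for $i=0$ to $|A|$, for each $Y\in \mathrm{Im}(f)$ with $|Y|=i$, and for each $z\in A\setminus label(Y)$, do the following: set $R\leftarrow\{z\}\cup label(Y)$ and $H\leftarrow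 label(f(R))$; if $|R|<|H|$, then set $label(f(R))\leftarrow R$ and $Continue\leftarrow True$. (4) Return $\{label(Y)\mid Y\in \mathrm{Im}(f)\}$; the set $label(Y)$ is the computed generator of $Y$. *)

(* Defs.v *)
From mathcomp Require Import all_boot.
Set Implicit Arguments.
Unset Strict Implicit.
Unset Printing Implicit Defensive.

Section PseudoClosure.

Context (A : finType) (f : {set A} -> {set A}).

Definition pseudo_closure : Prop :=
  forall X Y : {set A}, f (X :|: Y) = f (f X :|: f Y).

Definition size_increasing : Prop :=
  forall X Y : {set A}, X \subset Y -> #|f X| < #|f Y| \/ f X = f Y.

Definition Im : {set {set A}} := [set f X | X : {set A}].

Definition generates (X H : {set A}) : Prop := f X = H.

Definition minimum (X : {set A}) : Prop :=
  ~ exists Y : {set A}, #|Y| < #|X| /\ f X = f Y.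

Definition minimum_generator (X H : {set A}) : Prop :=
  generates X H /\ minimum X.

End PseudoClosure.

(* [label] is meaningful only on Im f; [time] is the running time so far.     *)
Record state (A : finType) := State {
  label : {set A} -> {set A};
  continue : bool;
  time : nat }.

(* The algorithm, with its running time.  Determining f (z |: X) from f X     *)
(* takes time [t X z], and determining f set0 takes time [t0].  Each other    *)
(* elementary step (an assignment, a test, reading a label, comparing         *)
(* cardinals, adding an element to a set, passing to the next element of a    *)
(* loop) takes one unit of time.                                              *)
(*   The pseudo-code leaves open the order in which "for each" visits Im f    *)
(* and A.  In pass k of the while loop, [ordIm k i] lists Im f for step i of  *)
(* the outer "for", and [ordA k Y] lists A for the loop on z at Y.            *)
Section MinGen.

Context (A : finType) (f : {set A} -> {set A}).
Context (t0 : nat) (t : {set A} -> A -> nat).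
Context (ordIm : nat -> nat -> seq {set A}) (ordA : nat -> {set A} -> seq A).

Definition tick (n : nat) (s : state A) : state A :=
  State (label s) (continue s) (time s + n).

Definition set_label (H X : {set A}) (s : state A) : state A :=
  tick 1 (State [eta label s with H |-> X] (continue s) (time s)).

Definition set_continue (b : bool) (s : state A) : state A :=
  tick 1 (State (label s) b (time s)).

Definition foreach (T : Type) (r : seq T) (body : T -> state A -> state A)
    (s : state A) : state A :=
  foldl (fun s x => body x (tick 1 s)) s r.

(* The #|Im f| ticks pay for removing f set0 from Im f.                       *)
Definition init : state A :=
  let s := State (fun=> set0) false (t0 + #|Im f|) in
  let s := foreach (enum (Im f :\ f set0)) (fun H => set_label H H) s in
  let s := set_label (f set0) set0 s in
  set_continue true s.

(* Since label(Y) generates Y throughout the run, f (label s Y) = Y is known  *)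
(* here and f R is obtained in time [t (label s Y) z].  The other 3 ticks are *)
(* for forming R, reading H and comparing the cardinals.                      *)
Definition relax (Y : {set A}) (z : A) (s : state A) : state A :=
  let R := z |: label s Y in
  let H := label s (f R) in
  let s' := tick (t (label s Y) z + 3) s in
  if #|R| < #|H| then set_continue true (set_label (f R) R s') else s'.

(* Selecting the Y of cardinal i scans Im f, and selecting the z outside      *)
(* label(Y) scans A.                                                          *)
Definition pass (k : nat) (s : state A) : state A :=
  foreach (iota 0 #|A|.+1) (fun i s =>
    foreach [seq Y : {set A} <- ordIm k i | #|Y| == i] (fun Y s =>
      foreach [seq z <- ordA k Y | z \notin label s Y] (relax Y)
        (tick #|A| s))
      (tick #|Im f| s))
    (set_continue false s).

(* [while_loop k s s'] : entered in state s after k passes, the loop          *)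
(* terminates, and does so in state s'.                                       *)
Inductive while_loop : nat -> state A -> state A -> Prop :=
| while_stop k s : ~~ continue s -> while_loop k s (tick 1 s)
| while_pass k s s' : continue s ->
    while_loop k.+1 (pass k (tick 1 s)) s' -> while_loop k s s'.

(* [MinGen G s] : the run terminates in state s and returns G.                *)
Definition MinGen (G : {set {set A}}) (s : state A) : Prop :=
  exists2 s' : state A, while_loop 0 init s' &
    s = tick #|Im f| s' /\ G = [set label s Y | Y in Im f].

End MinGen.

(* Main.v *)
(* Labels always generate, so f (z |: label Y) = f (z |: Y), and a relaxation at
   (Y, z) enforces |label (f (z |: Y))| <= |label Y| + 1.  A pass that changes
   nothing has enforced this for all Y and z at once; adding the elements of a
   set X one by one then gives |label (f X)| <= |X|, so every label is minimum.
   Every other pass decreases the sum of the label sizes, which is at most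
   |A| |Im f|.  If f is size-increasing, then along the chain of the f(X'), for
   X' growing to X one element at a time, the set strictly grows in cardinal
   whenever it changes, so the first pass relaxes the chain in order and the
   second pass changes nothing. *)
Require Import Defs.
From mathcomp Require Import all_boot zify.

Set Implicit Arguments.
Unset Strict Implicit.
Unset Printing Implicit Defensive.

(** * Finite sets *)

Lemma leq_cardsU1 (T : finType) (x : T) (B : {set T}) : #|x |: B| <= #|B|.+1.
Proof. by rewrite cardsU1; case: (x \notin B). Qed.

Lemma setU1_ind (T : finType) (P : {set T} -> Prop) :
    P set0 -> (forall x (X : {set T}), x \notin X -> P X -> P (x |: X)) ->
  forall X, P X.
Proof.
move=> P0 PU X; move: {2}#|X| (erefl #|X|) => n.
elim: n X => [|n IHn] X cardX; first by rewrite (cards0_eq cardX).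
have /card_gt0P[x xX] : 0 < #|X| by rewrite cardX.
rewrite -(setD1K xX); apply: PU; rewrite ?setD11 //; apply: IHn.
by apply/eqP; rewrite -eqSS -cardX [in X in _ == X](cardsD1 x) xX.
Qed.

(** * Loops: properties that propagate, and running time *)

Section Foreach.

Context (A : finType) (T : eqType).
Implicit Types (s : state A) (r : seq T) (body : T -> state A -> state A).

(** Each iteration of [foreach] starts with a tick, so a preorder that absorbs ticks passes from the
    body to the whole loop. *)
Definition tick_preorder (Q : state A -> state A -> Prop) : Prop :=
  [/\ forall s, Q s s,
      forall s1 s2 s3, Q s1 s2 -> Q s2 s3 -> Q s1 s3
    & forall n s, Q s (tick n s)].

Lemma foreach_preorder Q r body s :
  tick_preorder Q -> (forall x s1, Q s1 (body x s1)) ->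
  Q s (foreach r body s).
Proof.
move=> [Qxx Qtr Qtick] Qbody; rewrite /foreach.
elim: r s => //= x r IHr s.
exact: Qtr _ _ _ (Qtr _ _ _ (Qtick 1 s) (Qbody x _)) (IHr _).
Qed.

(** The loop is cut at an iteration on [x]: [s1] is the state that the body finds there. *)
Lemma foreach_visit Q r body s x :
  tick_preorder Q -> (forall y s1, Q s1 (body y s1)) -> x \in r ->
  exists s1, Q s s1 /\ Q (body x s1) (foreach r body s).
Proof.
move=> preQ Qbody; have [Qxx Qtr Qtick] := preQ; rewrite /foreach.
elim: r s => //= y r IHr s; rewrite inE => /predU1P[->|/IHr].
  exists (tick 1 s); split; first exact: Qtick.
  exact: foreach_preorder preQ Qbody.
case/(_ (body y (tick 1 s))) => s1 [Qs1 Q1]; exists s1; split=> //.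
exact: Qtr _ _ _ (Qtr _ _ _ (Qtick 1 s) (Qbody y _)) Qs1.
Qed.

Lemma time_foreach r body (b : T -> nat) s :
  (forall x s1, time (body x s1) <= time s1 + b x) ->
  time (foreach r body s) <= time s + \sum_(x <- r) (b x).+1.
Proof.
move=> le_body; rewrite /foreach.
elim: r s => [|x r IHr] s /=; first by rewrite big_nil addn0.
apply: leq_trans (IHr _) _; rewrite big_cons addnA leq_add2r.
by apply: leq_trans (le_body _ _) _; rewrite /= -addnA add1n.
Qed.

End Foreach.

(** * Pseudo-closures *)

Section PseudoClosureTheory.

Context (A : finType) (f : {set A} -> {set A}) (fP : pseudo_closure f).

Lemma pseudo_closure_id X : f (f X) = f X.
Proof. by have := fP X X; rewrite !setUid. Qed.

(** Both sides equal [f (f [set z] :|: f X)]. *)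
Lemma pseudo_closureU1 z X : f (z |: f X) = f (z |: X).
Proof. by rewrite fP pseudo_closure_id -fP. Qed.

Lemma mem_Im X : f X \in Im f.
Proof. exact: imset_f. Qed.

Lemma Im_fixed H : H \in Im f -> f H = H.
Proof. by case/imsetP=> X _ ->; apply: pseudo_closure_id. Qed.

Lemma card_Im_gt0 : 0 < #|Im f|.
Proof. by apply/card_gt0P; exists (f set0); apply: mem_Im. Qed.

End PseudoClosureTheory.

(** * Generating labels and their refinement *)

Section Run.

Context (A : finType) (f : {set A} -> {set A}) (fP : pseudo_closure f).
Context (cf t0 : nat) (t : {set A} -> A -> nat).
Context (t0_le : t0 <= cf) (t_le : forall X w, t X w <= cf).
Context (ordIm : nat -> nat -> seq {set A}) (ordA : nat -> {set A} -> seq A).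
Context (ordImP : forall k i, perm_eq (ordIm k i) (enum (Im f))).
Context (ordAP : forall k Y, perm_eq (ordA k Y) (enum A)).

Implicit Types (s : state A) (X Y H : {set A}) (k i : nat).

Local Notation relax := (relax f t).
Local Notation pass := (pass f t ordIm ordA).
Local Notation while_loop := (while_loop f t ordIm ordA).

(** The empty label of [f set0] is the base case when a set is built up from [set0]. No update
    touches it, since a size would have to be below 0. *)
Definition labels_generate s : Prop :=
  label s (f set0) = set0 /\ forall H, H \in Im f -> f (label s H) = H.

(** For labels that generate, this is minimality, in a form that allows induction on [X]. *)
Definition labels_optimal s : Prop := forall X, #|label s (f X)| <= #|X|.

Definition label_weight s : nat := \sum_(H in Im f) #|label s H|.

(** The premise lets every step refine any state unconditionally. The last three clauses are about
    the flag: once raised it stays raised; if it ends lowered, no label has changed; if it gets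
    raised on the way, the weight has dropped. *)
Definition refines s s' : Prop :=
  labels_generate s ->
  [/\ labels_generate s',
      forall H, H \in Im f -> #|label s' H| <= #|label s H|,
      continue s -> continue s',
      ~~ continue s' -> label s' = label s
    & continue s' -> continue s \/ label_weight s' < label_weight s].

Lemma refines_preorder : tick_preorder refines.
Proof.
split=> [s gen|s1 s2 s3 R12 R23 gen1|n s gen]; first by split=> //; left.
  have [gen2 le12 c12 l12 w12] := R12 gen1.
  have [gen3 le23 c23 l23 w23] := R23 gen2.
  have le_w12 : label_weight s2 <= label_weight s1 by apply: leq_sum.
  have le_w23 : label_weight s3 <= label_weight s2 by apply: leq_sum.
  split=> //.
  - by move=> H ImH; apply: leq_trans (le23 H ImH) (le12 H ImH).
  - by move=> /c12.
  - by move=> nc3; rewrite l23 // l12 //; apply: contra nc3.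
  - case/w23=> [/w12[c1|lt12]|lt23]; [by left|right|right].
      exact: leq_ltn_trans le_w23 lt12.
    exact: leq_trans lt23 le_w12.
by split=> //; left.
Qed.

Lemma refines_trans s2 s1 s3 : refines s1 s2 -> refines s2 s3 -> refines s1 s3.
Proof. by have [_ Rtr _] := refines_preorder; apply: Rtr. Qed.

Lemma refines_tick n s : refines s (tick n s).
Proof. by have [_ _] := refines_preorder; apply. Qed.
Arguments refines_tick n s : clear implicits.

Lemma f_label s Y z :
  labels_generate s -> Y \in Im f -> f (z |: label s Y) = f (z |: Y).
Proof.
by move=> [_ gen] ImY; rewrite -(pseudo_closureU1 fP z (label s Y)) gen.
Qed.

(* No update can hit Y itself, since label(Y) is contained in R. *)
Definition refines_at Y s s' : Prop :=
  refines s s' /\ (labels_generate s -> label s' Y = label s Y).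

Lemma refines_at_preorder Y : tick_preorder (refines_at Y).
Proof.
have [Rxx Rtr Rtick] := refines_preorder.
split=> [s|s1 s2 s3 [R12 e12] [R23 e23]|n s]; split=> //.
  exact: Rtr R23.
by move=> gen1; rewrite e23 ?e12 //; have [] := R12 gen1.
Qed.

Lemma refines_relax Y z s : refines_at Y s (relax Y z s).
Proof.
rewrite /Defs.relax; set R := z |: label s Y.
case: ifP => [lt_R|_]; last by split=> // gen; split=> //; left.
split=> [|[_ gen]] /=; last first.
  case: eqP lt_R => // <-.
  by rewrite ltnNge subset_leq_card // subsetUr.
move=> [gen0 gen]; have ImR := mem_Im f R.
have le_lab H : #|if H == f R then R else label s H| <= #|label s H|.
  by case: eqP => // ->; apply: ltnW.
split=> //=.
- split=> [|H ImH] /=; last by case: eqP => [->//|_]; apply: gen.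
  case: eqP => // e0; move: lt_R; rewrite -e0 gen0 cards0.
  by rewrite ltn0.
(* The term at [f R] drops strictly and no other term grows. *)
- move=> _; right; rewrite /label_weight /= [ltnRHS](bigD1 (f R)) //=.
  rewrite [ltnLHS](bigD1 (f R)) //= eqxx -addSn leq_add //.
  by apply: leq_sum.
Qed.

Lemma label_relax Y z s :
  labels_generate s -> Y \in Im f ->
  #|label (relax Y z s) (f (z |: Y))| <= #|label s Y|.+1.
Proof.
move=> gen ImY; rewrite /Defs.relax f_label //; case: ltnP => [_|le] /=.
  by rewrite eqxx leq_cardsU1.
exact: leq_trans le (leq_cardsU1 _ _).
Qed.

(** * Visits, rounds and passes *)

Definition visit k Y s : state A :=
  foreach [seq z <- ordA k Y | z \notin label s Y] (relax Y) (tick #|A| s).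

Definition round k i s : state A :=
  foreach [seq Y : {set A} <- ordIm k i | #|Y| == i] (visit k)
    (tick #|Im f| s).

Lemma passE k s :
  pass k s = foreach (iota 0 #|A|.+1) (round k) (set_continue false s).
Proof. by []. Qed.

Lemma refines_visit k Y s : refines s (visit k Y s).
Proof.
have [R _] := foreach_preorder [seq z <- ordA k Y | z \notin label s Y]
  (tick #|A| s) (refines_at_preorder Y) (refines_relax Y).
exact: (refines_trans (refines_tick #|A| s) R).
Qed.

Lemma refines_round k i s : refines s (round k i s).
Proof.
apply: (refines_trans (refines_tick #|Im f| s)).
exact: foreach_preorder refines_preorder (refines_visit k).
Qed.

Lemma refines_pass k s : refines (set_continue false s) (pass k s).
Proof. exact: foreach_preorder refines_preorder (refines_round k). Qed.

(** If [z] lies in the label, then [f (z |: Y) = Y]. Otherwise [z] is relaxed, and by [refines_at]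
    the label of [Y] is then still the one found on entry. *)
Lemma label_visit k Y z s :
  labels_generate s -> Y \in Im f ->
  #|label (visit k Y s) (f (z |: Y))| <= #|label s Y|.+1.
Proof.
move=> gen ImY; have [zY|zY] := boolP (z \in label s Y).
  have [_ le _ _ _] := refines_visit k Y gen.
  rewrite -(f_label z gen ImY) (setUidPr _) ?sub1set //.
  by rewrite gen.2 // (leq_trans (le Y ImY)).
have zr : z \in [seq z <- ordA k Y | z \notin label s Y].
  by rewrite mem_filter zY (perm_mem (ordAP k Y)) mem_enum.
have [s1 [[R1 e1] [R2 _]]] := foreach_visit (tick #|A| s)
  (refines_at_preorder Y) (refines_relax Y) zr.
have [gen1 _ _ _ _] := R1 gen; rewrite -[label s Y]/(label (tick #|A| s) Y).
rewrite -(e1 gen); apply: leq_trans (label_relax z gen1 ImY).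
have [] := R2; last by move=> _ le _ _ _; apply: le; apply: mem_Im.
by have [R _] := refines_relax Y z s1; have [] := R gen1.
Qed.

Lemma round_visit k i s Y :
  labels_generate s -> Y \in Im f -> #|Y| = i ->
  exists s1, refines s s1 /\ forall z,
    #|label (round k i s) (f (z |: Y))| <= #|label s1 Y|.+1.
Proof.
move=> gen ImY cardY.
have Yr : Y \in [seq Y : {set A} <- ordIm k i | #|Y| == i].
  by rewrite mem_filter cardY eqxx (perm_mem (ordImP k i)) mem_enum.
have [s1 [R1 R2]] := foreach_visit (tick #|Im f| s)
  refines_preorder (refines_visit k) Yr.
exists s1; split=> [|z]; first exact: (refines_trans (refines_tick _ _) R1).
have [gen1 _ _ _ _] := R1 gen.
have [gen2 _ _ _ _] := refines_visit k Y gen1.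
apply: leq_trans (label_visit k z gen1 ImY).
by have [_ le _ _ _] := R2 gen2; apply: le; apply: mem_Im.
Qed.

(** * Optimality after a pass without updates *)

(** Shortest paths from [f set0], with an edge of length 1 from [Y] to [f (z |: Y)]: when no edge
    can be relaxed, label sizes are bounded by path lengths, and [X] gives a path of length [#|X|]
    to [f X]. *)
Lemma labels_optimal_edges s :
    labels_generate s ->
    (forall Y z, Y \in Im f -> #|label s (f (z |: Y))| <= #|label s Y|.+1) ->
  labels_optimal s.
Proof.
move=> [gen0 _] edge; apply: setU1_ind => [|x X xX IHX].
  by rewrite gen0 cards0.
rewrite -pseudo_closureU1 // cardsU1 xX.
exact: leq_trans (edge _ _ (mem_Im f X)) _.
Qed.

(** A lowered flag means that the labels were constant during the pass, so the bounds obtained at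
    different moments all hold for the same labels. *)
Lemma last_pass_optimal k s :
  labels_generate s -> ~~ continue (pass k s) -> labels_optimal (pass k s).
Proof.
move=> gen nc.
have gen' : labels_generate (set_continue false s) by [].
have [genp _ _ _ _] := refines_pass k gen'.
apply: labels_optimal_edges => // Y z ImY.
have Yr : #|Y| \in iota 0 #|A|.+1 by rewrite mem_iota add0n ltnS max_card.
have [s1 [R1 R2]] := foreach_visit (set_continue false s)
  refines_preorder (refines_round k) Yr.
have [gen1 _ _ _ _] := R1 gen'.
have [s2 [R12 le2]] := round_visit k gen1 ImY erefl.
have [_ le12 _ _ _] := R12 gen1.
have [gen3 _ _ _ _] := refines_round k #|Y| gen1.
have [_ _ _ l3 _] := R2 gen3.
have [_ _ _ l1 _] := refines_trans (refines_round k #|Y| (s := s1)) R2 gen1.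
move: l3 l1; rewrite -passE => l3 l1.
rewrite {1}(l3 nc) (l1 nc); apply: leq_trans (le2 z) _.
by rewrite ltnS le12.
Qed.

(** * The size-increasing case *)

(** The invariant on entering round [i]: edges leaving sets of size below [i] were relaxed from
    labels that were already optimal. *)
Definition explored i s : Prop :=
  forall X z, #|f X| < i -> #|label s (f (z |: X))| <= #|X|.+1.

(** Adding [x] to [X] either keeps [f X], and the induction hypothesis applies, or makes it strictly
    larger, so that the old [f X] has size below [i]. Hence sets of size exactly [i] are optimal
    before round [i] starts. *)
Lemma explored_optimal i s X :
    size_increasing f -> labels_generate s -> explored i s ->
  #|f X| <= i -> #|label s (f X)| <= #|X|.
Proof.
move=> incf [gen0 _] expl; elim/setU1_ind: X => [|x X xX IHX] le_i.
  by rewrite gen0 cards0.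
rewrite cardsU1 xX add1n.
have [lt_fX|eq_fX] := incf X (x |: X) (subsetUr _ _).
  by apply: expl; apply: leq_trans le_i.
by rewrite -eq_fX ltnW // ltnS IHX // eq_fX.
Qed.

Lemma explored_round k i s :
    size_increasing f -> labels_generate s -> explored i s ->
  explored i.+1 (round k i s).
Proof.
move=> incf gen expl X z; rewrite ltnS leq_eqVlt => /predU1P[cardX|lt_i].
  have [s1 [R1 le1]] := round_visit k gen (mem_Im f X) cardX.
  have [_ le_s1 _ _ _] := R1 gen.
  rewrite -pseudo_closureU1 //; apply: leq_trans (le1 z) _.
  rewrite ltnS; apply: leq_trans (le_s1 _ (mem_Im f X)) _.
  by apply: explored_optimal incf gen expl _; rewrite cardX.
have [_ le _ _ _] := refines_round k i gen.
exact: leq_trans (le _ (mem_Im f _)) (expl X z lt_i).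
Qed.

Lemma explored_rounds k n s :
    size_increasing f -> labels_generate s ->
  explored n (foreach (iota 0 n) (round k) s).
Proof.
move=> incf gen; elim: n => // n IHn.
rewrite /foreach -addn1 iotaD foldl_cat addn1 add0n /=.
apply: explored_round => //.
by have [] := foreach_preorder (iota 0 n) s refines_preorder
  (refines_round k) gen.
Qed.

Lemma pass_optimal k s :
  size_increasing f -> labels_generate s -> labels_optimal (pass k s).
Proof.
move=> incf gen X; apply: (@explored_optimal #|A|.+1) => //.
- by have [] := refines_pass k (s := s).
- by rewrite passE; apply: explored_rounds.
- by rewrite ltnW // ltnS max_card.
Qed.

(** Each label of [s'] is itself a generator, so it competes with the optimal one. *)
Lemma optimal_weight s s' :
  labels_optimal s -> labels_generate s' -> label_weight s <= label_weight s'.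
Proof.
move=> opt [_ gen]; apply: leq_sum => H ImH.
by rewrite -{1}(gen H ImH) opt.
Qed.

(** * Cost of a pass and number of passes *)

(** The first product pays for the [#|A|.+1] rounds and their scans of [Im f], the second for one
    visit of each set, and the last 1 for lowering the flag. A relaxation costs [cf + 5], two units
    of which are the assignments, plus one loop tick. *)
Definition pass_cost : nat :=
  #|A|.+1 * #|Im f|.+1 + #|Im f| * (#|A| + #|A| * (cf + 6)).+1 + 1.

Lemma time_relax Y z s : time (relax Y z s) <= time s + (cf + 5).
Proof.
have := t_le (label s Y) z; rewrite /Defs.relax.
by case: ifP => _ /=; lia.
Qed.

Lemma time_visit k Y s :
  time (visit k Y s) <= time s + (#|A| + #|A| * (cf + 6)).
Proof.
apply: leq_trans (time_foreach _ _ (time_relax Y)) _.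
rewrite /= addnA leq_add2l -addnS big_const_seq count_predT iter_addn_0 mulnC.
rewrite leq_mul2r size_filter (leq_trans (count_size _ _)) ?orbT //.
by rewrite (perm_size (ordAP k Y)) -cardE.
Qed.

Lemma time_round k i s :
  time (round k i s) <= time s + (#|Im f| +
    (\sum_(Y in Im f) (#|Y| == i)) * (#|A| + #|A| * (cf + 6)).+1).
Proof.
apply: leq_trans (time_foreach _ _ (time_visit k)) _.
rewrite /= addnA leq_add2l big_const_seq count_predT iter_addn_0 mulnC.
rewrite leq_mul2r size_filter (permP (ordImP k i)) -sum1_count.
by rewrite big_enum_cond big_mkcondr orbC leqnn.
Qed.

Lemma time_pass k s : time (pass k s) <= time s + pass_cost.
Proof.
rewrite passE; apply: leq_trans (time_foreach _ _ (time_round k)) _.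
rewrite [time (set_continue _ _)]/= /pass_cost -addnA leq_add2l addnC leq_add2r.
under eq_bigr => i _ do rewrite -addSn.
rewrite big_split big_const_seq count_predT iter_addn_0 size_iota mulnC.
rewrite leq_add2l -big_distrl leq_mul2r; apply/orP; right.
(* Summing over [Y] first: a set has a single size, so it is visited in at most one round. *)
rewrite exchange_big -[leqRHS]sum1_card; apply: leq_sum => Y _.
under eq_bigr => i _ do rewrite eq_sym.
rewrite -big_mkcond sum1_count.
by rewrite count_uniq_mem ?iota_uniq // leq_b1.
Qed.

(* The number of remaining passes is bounded by how much weight can still be
   lost. *)
Lemma while_loop_optimal n k s :
    labels_generate s -> continue s ->
    (forall s', labels_generate s' -> label_weight s <= label_weight s' + n) ->
  exists s', [/\ while_loop k s s', labels_generate s', labels_optimal s'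
    & time s' <= time s + 1 + pass_cost.+1 * n.+1].
Proof.
elim: n k s => [|n IHn] k s gen cs lb; set s1 := pass k (tick 1 s).
all: have [gen1 le1 _ _ w1] := refines_pass k (s := tick 1 s) gen.
all: have time1 : time s1 <= time s + 1 + pass_cost := time_pass k (tick 1 s).
all: have [c1|nc1] := boolP (continue s1).
(* With no weight left to lose, no pass can raise the flag. *)
- case: (w1 c1) => // lt1; have := leq_trans lt1 (lb _ gen1).
  by rewrite addn0 ltnn.
- exists (tick 1 s1); split=> //; first exact/while_pass/while_stop.
    exact: last_pass_optimal.
  by rewrite /=; lia.
- case: (w1 c1) => // lt1.
  have lb1 s' : labels_generate s' -> label_weight s1 <= label_weight s' + n.
    by move/lb; move: lt1; rewrite /label_weight /= -/s1; lia.
  have [s' [run gen' opt' time']] := IHn k.+1 s1 gen1 c1 lb1.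
  exists s'; split=> //; first exact: while_pass.
  by rewrite /=; lia.
- exists (tick 1 s1); split=> //; first exact/while_pass/while_stop.
    exact: last_pass_optimal.
  by rewrite /=; lia.
Qed.

(** * Initialization and the whole run *)

Local Notation init := (init f t0).

Lemma label_init H :
  label init H = if (H \in Im f) && (H != f set0) then H else set0.
Proof.
rewrite /Defs.init /=; case: eqP => [->|/eqP neH]; first by rewrite andbF.
have lab (r : seq {set A}) s :
  label (foreach r (fun H => set_label H H) s) H
    = if H \in r then H else label s H.
  rewrite /foreach; elim: r s => //= K r IHr s.
  rewrite IHr inE /=; case: (H \in r); rewrite ?orbT ?orbF //.
  by case: (H =P K) => [->|].
by rewrite lab mem_enum in_setD1 neH andbT.
Qed.

Lemma labels_generate_init : labels_generate init.
Proof.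
split=> [|H ImH]; rewrite label_init ?eqxx ?andbF // ImH /=.
by case: eqP => //= _; apply: Im_fixed.
Qed.

Lemma time_init : time init <= cf + 3 * #|Im f| + 2.
Proof.
have timeF : time (foreach (enum (Im f :\ f set0)) (fun H => set_label H H)
    (State (fun=> set0) false (t0 + #|Im f|))) <= t0 + #|Im f| + 2 * #|Im f|.
  apply: leq_trans (time_foreach (b := fun=> 1) _ _ _) _ => //.
  rewrite big_const_seq count_predT iter_addn_0 -cardE leq_add2l leq_mul2l.
  by rewrite subset_leq_card // subD1set.
move: timeF t0_le; rewrite /Defs.init /=; set T := time _; lia.
Qed.

Lemma label_weight_le s : label_weight s <= #|A| * #|Im f|.
Proof.
rewrite mulnC -sum_nat_const; apply: leq_sum => H _; exact: max_card.
Qed.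

Lemma MinGen_run :
  exists s' n, [/\ while_loop 0 init s', labels_generate s',
    labels_optimal s' & [/\ time s' <= cf + 3 * #|Im f| + 4 + pass_cost +
                              pass_cost.+1 * n.+1,
    n <= #|A| * #|Im f| & size_increasing f -> n = 0]].
Proof.
have gen0 : labels_generate (tick 1 init) := labels_generate_init.
have time1 : _ <= time init + 1 + pass_cost := time_pass 0 (tick 1 init).
have timei := time_init; set m := #|Im f| in timei *.
have [gen1 _ _ _ _] := refines_pass 0 (s := tick 1 init) gen0.
set s1 := pass 0 (tick 1 init) in time1 gen1 *.
have [c1|nc1] := boolP (continue s1); last first.
  exists (tick 1 s1), 0; split=> //; first exact/while_pass/while_stop.
    exact: last_pass_optimal.
  by split=> //; rewrite /=; lia.
(* [n] bounds the weight that can be lost after the first pass. Testing optimality lets one witness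
   serve both time bounds. *)
pose n := if [forall X, #|label s1 (f X)| <= #|X|] then 0 else #|A| * m.
have [|s' [run gen opt time']] := while_loop_optimal (n := n) 1 gen1 c1.
  move=> s' gen'; rewrite /n; case: forallP => [opt|_].
    by rewrite addn0 optimal_weight.
  exact: leq_trans (label_weight_le _) (leq_addl _ _).
exists s', n; split=> //; first exact: while_pass.
split; first by rewrite /=; lia.
  by rewrite /n; case: ifP.
move=> incf; rewrite /n; case: forallP => // [[]].
exact: pass_optimal.
Qed.

Lemma optimal_minimum_generator s H :
    labels_generate s -> labels_optimal s -> H \in Im f ->
  minimum_generator f (label s H) H.
Proof.
move=> [_ gen] opt ImH; split; first exact: gen.
by case=> X [ltX]; rewrite gen // => eqH; move: (opt X); rewrite -eqH leqNgt ltX.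
Qed.

End Run.

(** * Correctness and explicit constants *)

Theorem theorem2p3 :
  exists C1 C2 : nat,
  forall (A : finType) (f : {set A} -> {set A}) (cf t0 : nat)
    (t : {set A} -> A -> nat)
    (ordIm : nat -> nat -> seq {set A}) (ordA : nat -> {set A} -> seq A),
  pseudo_closure f ->
  0 < cf -> t0 <= cf -> (forall (X : {set A}) (w : A), t X w <= cf) ->
  (forall k i : nat, perm_eq (ordIm k i) (enum (Im f))) ->
  (forall (k : nat) (Y : {set A}), perm_eq (ordA k Y) (enum A)) ->
  exists (G : {set {set A}}) (s : state A),
    [/\ MinGen f t0 t ordIm ordA G s,
        forall H : {set A}, H \in Im f ->
          label s H \in G /\ minimum_generator f (label s H) H,
        0 < #|A| -> time s <= C1 * (cf * (#|A| * #|Im f|) ^ 2)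
      & 0 < #|A| -> size_increasing f ->
          time s <= C2 * (cf * #|A| * #|Im f|)].
Proof.
(* With [P = cf * #|A| * #|Im f|], a pass costs at most [14 * P], or [15 * P] with its loop test,
   and the first pass with initialization and output at most [23 * P]. Then 38 is 23 + 15, for
   [n = 0], and 53 is 23 + 15 * 2, from [n.+1 <= 2 * (#|A| * #|Im f|)]. *)
exists 53, 38 => A f cf t0 t ordIm ordA fP cf_gt0 t0_le t_le ordImP ordAP.
have [s' [n [run gen opt [time_s' le_n n0]]]] :=
  MinGen_run fP t0_le t_le ordImP ordAP.
exists [set label s' Y | Y in Im f], (tick #|Im f| s').
have time_s : 0 < #|A| ->
    time (tick #|Im f| s') <= 23 * (cf * #|A| * #|Im f|)
      + 15 * (cf * #|A| * #|Im f|) * n.+1.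
  move=> A_gt0; have I_gt0 := card_Im_gt0 f.
  move: time_s'; rewrite /pass_cost /=.
  have -> : cf * #|A| * #|Im f| = cf * (#|A| * #|Im f|) by rewrite mulnA.
  set a := #|A| in A_gt0 *; set m := #|Im f| in I_gt0 *.
  set P := cf * (a * m).
  have le_am : a * m <= P by rewrite leq_pmull.
  have le_cf : cf <= P by rewrite leq_pmulr // muln_gt0 A_gt0.
  have le_a : a <= a * m by rewrite leq_pmulr.
  have le_m : m <= a * m by rewrite leq_pmull.
  have cost : a.+1 * m.+1 + m * (a + a * (cf + 6)).+1 + 1 <= 14 * P.
    have -> : a.+1 * m.+1 + m * (a + a * (cf + 6)).+1 + 1
      = 8 * (a * m) + P + a + m * 2 + 2 by rewrite /P; lia.
    lia.
  have : (a.+1 * m.+1 + m * (a + a * (cf + 6)).+1 + 1).+1 * n.+1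
    <= 15 * P * n.+1 by rewrite leq_mul2r; lia.
  lia.
split=> [|H ImH|A_gt0|A_gt0 incf].
- by exists s'.
- by split; [apply: imset_f|apply: optimal_minimum_generator].
- apply: leq_trans (time_s A_gt0) _.
  have I_gt0 := card_Im_gt0 f.
  rewrite -mulnA; set q := #|A| * #|Im f| in le_n *.
  have q_gt0 : 0 < q by rewrite muln_gt0 A_gt0.
  have : cf * q <= cf * q ^ 2 by rewrite leq_mul2l leq_pmulr ?orbT.
  have : cf * q * n.+1 <= 2 * (cf * q ^ 2).
    rewrite (mulnC 2) -!mulnA !leq_mul2l; apply/orP; right; apply/orP; right.
    lia.
  lia.
- by apply: leq_trans (time_s A_gt0) _; rewrite n0 //; lia.
Qed.
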